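(* Let $r\geq 3$ and $n\geq 4r^2$ be integers. If $\mathcal{H}\subseteq\binom{[n]}{r}$ is a non-trivial intersecting $r$-uniform hypergraph, then $\sigma_r(\mathcal{H})\leq r\left(\binom{n-2}{r-2}-\binom{n-r-2}{r-2}\right)$.
   Context: An $r$-uniform hypergraph $\mathcal{H}\subseteq\binom{[n]}{r}$ is a family of $r$-subsets of $[n]=\{1,\dots,n\}$ (its edges). The degree $\deg(v)$ of a vertex $v$ is the number of edges containing $v$; for an $r$-set $S$, $\deg(S)=\sum_{v\in S}\deg(v)$. The Ore-degree $\sigma_r(\mathcal{H})$ is the minimum of $\deg(S)$ over all $r$-subsets $S\subseteq[n]$ with $S\notin\mathcal{H}$. $\mathcal{H}$ is intersecting if every two edges intersect. An intersecting hypergraph is trivial if it is contained in a $1$-star (the family of all $r$-subsets of $[n]$ containing a fixed vertex), i.e. all edges share a common vertex; otherwise it is non-trivial. *)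

(* Defs.v *)
From mathcomp Require Import all_boot.

Set Implicit Arguments.
Unset Strict Implicit.
Unset Printing Implicit Defensive.

Section Hypergraph.
Variable n : nat.
Implicit Types (H : {set {set 'I_n}}) (S A B : {set 'I_n}) (v : 'I_n).

Definition uniform (r : nat) H : Prop := forall A, A \in H -> #|A| = r.

Definition deg H v : nat := #|[set A in H | v \in A]|.

Definition set_deg H S : nat := \sum_(v in S) deg H v.

Definition nonedges (r : nat) H : {set {set 'I_n}} :=
  [set S : {set 'I_n} | (#|S| == r) && (S \notin H)].

(* The start value r * #|H| bounds set_deg H S for every r-set S, so it does
   not affect the minimum as soon as a non-edge exists: see ore_degree_le and
   ore_degree_attained. *)
Definition ore_degree (r : nat) H : nat :=
  \big[minn/r * #|H|]_(S in nonedges r H) set_deg H S.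

Definition intersecting H : Prop :=
  forall A B, A \in H -> B \in H -> A :&: B != set0.

Definition star (r : nat) v : {set {set 'I_n}} :=
  [set A : {set 'I_n} | (#|A| == r) && (v \in A)].

Definition trivial_family (r : nat) H : Prop := exists v, H \subset star r v.

Lemma ore_degree_le r H S : S \in nonedges r H -> ore_degree r H <= set_deg H S.
Proof.
rewrite /ore_degree -big_filter -[_ \in _]andbT => SN.
have: S \in [seq S <- index_enum {set 'I_n} | S \in nonedges r H].
  by rewrite mem_filter mem_index_enum.
elim: [seq _ <- _ | _] => //= A s IH; rewrite inE big_cons geq_min.
by case/orP=> [/eqP->|/IH->]; rewrite ?leqnn ?orbT.
Qed.

Lemma ore_degree_attained r H :
  nonedges r H != set0 ->
  exists2 S, S \in nonedges r H & ore_degree r H = set_deg H S.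
Proof.
case/set0Pn=> S0 S0N.
have: ore_degree r H = r * #|H| \/
      exists2 S, S \in nonedges r H & ore_degree r H = set_deg H S.
  rewrite /ore_degree; elim/big_rec: _ => [|S x SN IH]; first by left.
  case: (leqP (set_deg H S) x) => _ //; by right; exists S.
case=> // E; exists S0 => //; apply/eqP; rewrite eqn_leq ore_degree_le //= E.
move: S0N; rewrite inE => /andP[/eqP<- _].
rewrite /set_deg -sum_nat_const; apply: leq_sum => v _.
by rewrite /deg subset_leq_card //; apply/subsetP=> A; rewrite inE => /andP[].
Qed.

End Hypergraph.

(* Main.v *)
Require Import Defs.
From mathcomp Require Import all_boot.
From mathcomp Require Import zify.

(** Write D for the difference of binomials in the bound and c for
    'C(n - 3, r - 3); then 7 r c <= 8 D.  If 2r vertices have degree at most D,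
    two disjoint r-sets of such vertices exist, and one of them is a non-edge.
    So it suffices to find 2r vertices of degree at most D.

    Let s be the least size of a vertex cover of H; s >= 2 by non-triviality.
    If s >= 3, branch from a minimum cover: s choices for a first vertex, then r
    choices (from an edge missed so far) until s vertices are fixed, so that
    |H| <= s r^(s-1) 'C(n-s, r-s) <= 3 r^2 c, and Markov's inequality for
    the degrees concludes.

    If {x, y} is a cover, let B be the edges avoiding x and A those avoiding y.
    - Some z <> y lies in all of B and in all of A: every edge contains two of
      x, y, z, and other vertices have degree at most 3 c <= D.
    - Some z <> y lies in all of B, but not in A0 in A: then |B| <= (r-1) c.
      The edges through x and v all meet a given E1 in B, so they are at most D
      in number, and at most D - 'C(n-3-r, r-3) if B has a second edge;
      Markov's inequality bounds the contribution of B to the degree of v.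
    - The same with x and y exchanged.
    - Otherwise |A|, |B| <= (r-1)^2 c, at most c edges contain x, y, v, and
      Markov's inequality is applied to A and B together. *)

Set Implicit Arguments.
Unset Strict Implicit.
Unset Printing Implicit Defensive.

(** * Binomial estimates and the closing inequalities *)

Section Binomials.

(** A unit step down from [m - i] loses ['C(m - i - 1, j - 1)]. By absorption this is at most
    [j / M] times ['C(m, j)], as the upper index stays at least [M]. *)
Lemma bin_sub_lower (m j M i : nat) : M + i <= m ->
  M * 'C(m, j) <= M * 'C(m - i, j) + i * j * 'C(m, j).
Proof.
elim: i => [|i IH] le_m; first by rewrite subn0; lia.
have {IH} := IH ltac:(lia).
case: j => [|j]; first by rewrite !bin0; lia.
have -> : m - i = (m - i.+1).+1 by lia.
have H1 := mul_bin_diag (m - i.+1).+1 j.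
have H2 : 'C((m - i.+1).+1, j.+1) <= 'C(m, j.+1) by apply: leq_bin2l; lia.
have H3 : M * 'C(m - i.+1, j) <= j.+1 * 'C(m, j.+1).
  apply: leq_trans (leq_mul (leqnn _) H2); rewrite -H1 /=.
  by apply: leq_mul => //; lia.
rewrite binS; lia.
Qed.

(** The difference telescopes into the terms ['C(m - i, j)] with [i < k]. By [bin_sub_lower] each
    falls short of ['C(m, j)] by a fraction of at most [i * j / M], and these [i] sum to
    [k * k.-1 / 2]. *)
Lemma bin_diff_lower (m j M k : nat) : M + k <= m.+1 ->
  8 * M * (k * 'C(m, j)) <=
  8 * M * ('C(m.+1, j.+1) - 'C(m.+1 - k, j.+1)) + 4 * (k * k.-1) * j * 'C(m, j).
Proof.
elim: k => [|k IH] le_m; first by rewrite !mul0n !muln0.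
have {IH} := IH ltac:(lia).
have H := @bin_sub_lower m j M k ltac:(lia).
have E : m.+1 - k = (m - k).+1 by lia.
have E' : m.+1 - k.+1 = m - k by lia.
have le1 : 'C(m.+1 - k, j.+1) <= 'C(m.+1, j.+1) by apply: leq_bin2l; lia.
have Q : 'C(m.+1, j.+1) - 'C(m.+1 - k.+1, j.+1) =
   'C(m.+1, j.+1) - 'C(m.+1 - k, j.+1) + 'C(m - k, j).
  by move: le1; rewrite E E' [in 'C((m-k).+1, j.+1)]binS; lia.
rewrite Q /=; move: ('C(m.+1, _) - _) => Z.
have -> : k.+1 * k = k * k.-1 + 2 * k.
  by case: k {H le_m E E' le1 Q} => // k /=; lia.
move: 'C(m,j) 'C(m-k, j) (k * k.-1) H => c d P; lia.
Qed.

(** Otherwise [b >= n - 4 * r], and cancelling [l] leaves [3 * (n - 4 * r) <= 4 * r * (r - 1)],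
    against [n >= 4 * r ^ 2]. *)
Lemma pencil_arith (n r c l b k : nat) : 2 < r -> 4 * r ^ 2 <= n -> 0 < c ->
  3 * c <= 4 * l -> b * l.+1 <= r * k -> k <= (r - 1) * c ->
  1 + (r + r) + b + 2 * r <= n.
Proof.
move=> hr hn c0 ll mk kc; rewrite leqNgt; apply/negP=> hb.
have h1 : (n - 4 * r) * l <= b * l by apply: leq_mul => //; lia.
have h2 : r * k <= r * ((r - 1) * c) by rewrite leq_mul.
have h3 : r * (r - 1) * (3 * c) <= r * (r - 1) * (4 * l) by rewrite leq_mul.
have : l * (3 * (n - 4 * r)) <= l * (4 * (r * (r - 1))).
  move: h1 h2 h3 mk; move: (n - 4 * r) (r - 1) => p q; lia.
rewrite leq_pmul2l; last by lia.
nia.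
Qed.

Lemma two_cover_arith (n r c D b k : nat) : 2 < r -> 4 * r ^ 2 <= n -> 0 < c ->
  7 * (r * c) <= 8 * D -> b * (D - c).+1 <= r * k ->
  k <= (r - 1) * ((r - 1) * c) + (r - 1) * ((r - 1) * c) ->
  2 + b + 2 * r <= n.
Proof.
move=> hr hn c0 Dl mk kc; rewrite leqNgt; apply/negP=> hb.
have h0 : (7 * r - 8) * c <= 8 * (D - c) by rewrite mulnBl; lia.
have h1 : (n - 2 * r - 1) * ((7 * r - 8) * c) <= b * (8 * (D - c)).
  by apply: leq_mul => //; lia.
have h2 := leq_mul (leqnn r) kc.
have : c * ((n - 2 * r - 1) * (7 * r - 8)) <= c * (16 * (r * ((r - 1) * (r - 1)))).
  move: h1 h2 mk; move: (n - 2 * r - 1) (7 * r - 8) (r - 1) (D - c) => p q s t; lia.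
rewrite leq_pmul2l // => h4.
have h5 : (4 * r ^ 2 - 2 * r - 1) * (7 * r - 8) <= 16 * (r * ((r - 1) * (r - 1))).
  by apply: leq_trans h4; apply: leq_mul => //; lia.
(* Writing [r = q + 3] removes the truncated subtractions; the left polynomial in [q] then exceeds
   the right one coefficientwise. *)
case: r hr h5 {hn Dl mk kc hb h0 h1 h2 h4} => [|[|[|q]]] // _.
have -> : 7 * q.+3 - 8 = 7 * q + 13 by lia.
have -> : 4 * q.+3 ^ 2 - 2 * q.+3 - 1 = 4 * q ^ 2 + 22 * q + 29 by nia.
have -> : q.+3 - 1 = q + 2 by lia.
nia.
Qed.

End Binomials.

(** * Double counting in uniform families *)

Section Counting.
Variable n : nat.
Implicit Types (H K : {set {set 'I_n}}) (S T F E W : {set 'I_n}) (v x y : 'I_n).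

Lemma exists_subset_card F k : k <= #|F| -> exists2 S : {set 'I_n}, S \subset F & #|S| = k.
Proof.
rewrite -bin_gt0 -cards_draws => /card_gt0P[S].
by rewrite inE => /andP[sSF /eqP cS]; exists S.
Qed.

Definition draws_between (r : nat) T F : {set {set 'I_n}} :=
  [set E : {set 'I_n} | [&& #|E| == r, T \subset E & [disjoint E & F]]].

(** [S] goes to [T :|: S], a bijection from the [(r - #|T|)]-subsets of the complement of
    [T :|: F]. *)
Lemma card_draws_between r T F : [disjoint T & F] -> #|T| <= r ->
  #|draws_between r T F| = 'C(n - #|T| - #|F|, r - #|T|).
Proof.
move=> dTF leTr.
have cC : #|~: (T :|: F)| = n - #|T| - #|F|.
  rewrite cardsCs setCK card_ord cardsU.
  by move: dTF; rewrite -setI_eq0 => /eqP->; rewrite cards0 subn0 subnDA.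
rewrite -cC -cards_draws.
have dT S : S \subset ~: (T :|: F) -> T :&: S = set0.
  move=> sS; apply/eqP; rewrite setI_eq0 disjoint_sym; apply: disjointWl sS _.
  by rewrite -setI_eq0; apply/eqP/setP=> u; rewrite !inE;
    case: (u \in T); rewrite ?andbF.
rewrite -(card_in_imset (f := fun S => T :|: S)); last first.
  move=> S S'; rewrite !inE => /andP[/dT dS _] /andP[/dT dS' _] eU.
  have := congr1 (fun S => S :\: T) eU; rewrite !setDUl setDv !set0U.
  by rewrite !(setDidPl _) // -setI_eq0 setIC ?dS ?dS'.
congr #|pred_of_set _|; apply/setP=> E; apply/idP/imsetP.
  rewrite inE => /and3P[/eqP cE sTE dEF]; exists (E :\: T); last first.
    by rewrite -{1}(setID E T) (setIidPr sTE).
  rewrite inE cardsD (setIidPr sTE) cE eqxx andbT; apply/subsetP=> u.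
  rewrite !inE => /andP[uT uE]; rewrite (negPf uT) /=.
  by move: dEF => /disjointFr ->.
case=> S; rewrite inE => /andP[sS /eqP cS] ->; rewrite inE subsetUl /=.
rewrite cardsU dT // cards0 subn0 cS subnKC // eqxx /=.
rewrite -setI_eq0 setIUl; apply/eqP/setP=> u; rewrite !inE.
have := disjointFr dTF (x := u); have := subsetP sS u; rewrite !inE.
case: (u \in T) => [_ ->//|]; case: (u \in S) => //= /(_ isT).
by case: (u \in F).
Qed.

Lemma card_supersets_le r K T : uniform r K -> #|T| <= r ->
  (forall E, E \in K -> T \subset E) -> #|K| <= 'C(n - #|T|, r - #|T|).
Proof.
move=> uK leT sK; have d0 (S : {set 'I_n}) : [disjoint S & set0].
  by rewrite -setI_eq0 setI0.
have := card_draws_between (d0 T) leT; rewrite cards0 subn0 => <-.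
by apply/subset_leq_card/subsetP=> E EK; rewrite inE (uK _ EK) eqxx sK // d0.
Qed.

Lemma sum_deg K W : \sum_(u in W) deg K u = \sum_(E in K) #|E :&: W|.
Proof.
rewrite /deg; under eq_bigr => u _ do rewrite -sum1dep_card big_mkcondr /=.
rewrite exchange_big /=; apply: eq_bigr => E _.
rewrite -sum1_card -big_mkcondr /=; apply: eq_bigl => u.
by rewrite inE andbC.
Qed.

Lemma card_le_through F b K : (forall E, E \in K -> E :&: F != set0) ->
  (forall u, u \in F -> deg K u <= b) -> #|K| <= #|F| * b.
Proof.
move=> mK bK; rewrite -sum_nat_const.
apply: leq_trans (leq_sum _ (fun u uF => bK u uF)).
rewrite sum_deg -sum1_card; apply: leq_sum => E EK.
by rewrite card_gt0 mK.
Qed.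

Lemma deg_markov r K W t : uniform r K ->
  #|[set v in W | t < deg K v]| * t.+1 <= r * #|K|.
Proof.
move=> uK; rewrite -sum_nat_const mulnC -sum_nat_const.
apply: (@leq_trans (\sum_(v in W) deg K v)); last first.
  rewrite sum_deg; apply: leq_sum => E EK.
  by rewrite -(uK _ EK) subset_leq_card // subsetIl.
rewrite (eq_bigl (fun v => (v \in W) && (t < deg K v))) => [|v];
  last by rewrite inE.
rewrite big_mkcondr /=; apply: leq_sum => v _; by case: ltnP.
Qed.

Lemma deg_split K x v :
  deg K v = deg [set E in K | x \in E] v + deg [set E in K | x \notin E] v.
Proof.
rewrite /deg -(cardsID [set E : {set 'I_n} | x \in E] [set E in K | v \in E]).
congr (_ + _); apply: eq_card => E; rewrite !inE.
- by rewrite andbAC.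
- by rewrite andbA [_ && (E \in K)]andbC.
Qed.

Lemma ore_degree_le_of_low_degrees r D H : intersecting H -> 0 < r ->
  2 * r <= #|[set v | deg H v <= D]| -> ore_degree r H <= r * D.
Proof.
move=> iH r0 cL; set L := [set v | _] in cL.
have [S1 sS1 cS1] : exists2 S : {set 'I_n}, S \subset L & #|S| = r.
  by apply: exists_subset_card; apply: leq_trans cL; lia.
have [S2 sS2 cS2] : exists2 S : {set 'I_n}, S \subset L :\: S1 & #|S| = r.
  by apply: exists_subset_card; rewrite cardsD (setIidPr sS1) cS1;
    apply: leq_trans (leq_sub2r _ cL); lia.
have low S : S \subset L -> #|S| = r -> S \notin H -> ore_degree r H <= r * D.
  move=> sS cS nS; apply: (leq_trans (@ore_degree_le _ r H S _)).
    by rewrite inE cS eqxx.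
  rewrite -cS -sum_nat_const; apply: leq_sum => v /(subsetP sS).
  by rewrite inE.
have [S1H|] := boolP (S1 \in H); last exact: low.
apply: (low S2) => //; first exact: subset_trans sS2 (subsetDl _ _).
apply/negP=> S2H; have /negP[] := iH _ _ S1H S2H.
rewrite setI_eq0 disjoint_sym; apply: disjointWl sS2 _.
by rewrite disjoint_sym disjoints_subset; apply/subsetP=> u; rewrite !inE => ->.
Qed.

End Counting.

(** * Constants of the extremal problem *)

Section Extremal.
Variables (n r : nat) (H : {set {set 'I_n}}).
Hypotheses (hr : 2 < r) (hn : 4 * r ^ 2 <= n).
Hypotheses (uH : uniform r H) (iH : intersecting H).
Implicit Types (K : {set {set 'I_n}}) (T E : {set 'I_n}) (u v x y z : 'I_n).

Let c := 'C(n - 3, r - 3).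
(** The number of [r]-sets through three given vertices that miss an [r]-set avoiding these. *)
Let l := 'C(n - 3 - r, r - 3).
(** The number of [r]-sets through two given vertices that meet an [r]-set avoiding both. *)
Let D := 'C(n - 2, r - 2) - 'C(n - r - 2, r - 2).
Let low := [set v | deg H v <= D].

Lemma c_gt0 : 0 < c.
Proof. by rewrite bin_gt0; nia. Qed.

Lemma D_lower : 7 * (r * c) <= 8 * D.
Proof.
have := @bin_diff_lower (n - 3) (r - 3) (n - r - 3) r ltac:(nia).
have -> : (n - 3).+1 = n - 2 by nia.
have -> : (r - 3).+1 = r - 2 by lia.
have -> : n - 2 - r = n - r - 2 by lia.
rewrite -/c -/D => H0.
(* With [M = n - r - 3], this makes the error term of [bin_diff_lower] at most one eighth of the
   main term [8 * M * (r * c)]. *)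
have M1 : 4 * (r.-1 * (r - 3)) <= n - r - 3 by nia.
have M0 : 0 < n - r - 3 by nia.
have M2 : 4 * (r * r.-1) * (r - 3) * c <= (n - r - 3) * (r * c).
  apply: leq_trans (leq_mul M1 (leqnn (r * c))); by lia.
rewrite -(leq_pmul2l M0); move: H0 M2; move: (n - r - 3) => M.
lia.
Qed.

Lemma l_lower : 3 * c <= 4 * l.
Proof.
have := @bin_sub_lower (n - 3) (r - 3) (n - r - 3) r ltac:(nia).
rewrite -/c -/l => H0.
have M1 : 4 * (r * (r - 3)) <= n - r - 3 by nia.
have M0 : 0 < n - r - 3 by nia.
have M2 : 4 * (r * (r - 3)) * c <= (n - r - 3) * c by apply: leq_mul.
rewrite -(leq_pmul2l M0); lia.
Qed.

Lemma uniformW K : K \subset H -> uniform r K.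
Proof. by move=> sK E /(subsetP sK) /uH. Qed.

(** * Families without a cover of two vertices *)

(** While [T] has fewer than [s] vertices, some edge [F] misses it. Every edge containing [T] meets
    [F], so [T] extends by one of the [r] vertices of [F]. *)
Lemma codeg_le s T :
  (forall T', #|T'| < s -> exists2 E, E \in H & [disjoint T' & E]) ->
  s <= r -> #|T| <= s ->
  #|[set E in H | T \subset E]| <= r ^ (s - #|T|) * 'C(n - s, r - s).
Proof.
move=> hs sr; move Ek: (s - #|T|) => k.
elim: k T Ek => [|k IH] T Ek leT.
  have eT : #|T| = s by lia.
  rewrite mul1n -eT; apply: card_supersets_le; rewrite ?eT //.
    by apply: uniformW; apply/subsetP=> E; rewrite inE => /andP[].
  by move=> E; rewrite inE => /andP[].
have [F FH dTF] := hs T ltac:(lia).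
rewrite expnS -mulnA -{1}(uH FH); apply: card_le_through.
  by move=> E; rewrite inE => /andP[EH _]; exact: iH.
move=> u uF; have uT : u \notin T by rewrite (disjointFl dTF uF).
have cuT : #|u |: T| = #|T|.+1 by rewrite cardsU1 uT.
apply: leq_trans (IH (u |: T) _ _); try lia.
apply/subset_leq_card/subsetP=> E; rewrite !inE => /andP[/andP[-> sT] uE].
by rewrite subUset sub1set uE.
Qed.

(** Passing from [s] to [s + 1] multiplies the bound by [(s + 1) / s * r * (r - s) / (n - s)], which
    is at most 1 because [2 * r * (r - s) <= n - s]. *)
Lemma branching_bound_mono s : 3 <= s -> s <= r ->
  s * (r ^ s.-1 * 'C(n - s, r - s)) <= 3 * (r ^ 2 * c).
Proof.
elim: s => // s IH; rewrite leq_eqVlt => /orP[/eqP<-//|s3 sr].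
apply: leq_trans (IH _ _); [|lia..].
case: s s3 sr {IH} => // s s3 sr; rewrite !succnK expnS.
have := mul_bin_diag (n - s.+1) (r - s.+2).
have -> : (n - s.+1).-1 = n - s.+2 by lia.
have -> : (r - s.+2).+1 = r - s.+1 by lia.
move: 'C(n - s.+2, _) 'C(n - s.+1, _) => C' C eC.
suff : s.+2 * r * C' <= s.+1 * C.
  move=> h; rewrite [_ * (_ * C)]mulnCA;
  apply: leq_trans (leq_mul (leqnn _) h); lia.
have M0 : 0 < n - s.+1 by nia.
rewrite -(leq_pmul2l M0).
have -> : (n - s.+1) * (s.+2 * r * C') = s.+2 * r * ((n - s.+1) * C') by lia.
rewrite eC.
have M1 : 2 * (r * (r - s.+1)) <= n - s.+1 by nia.
have M2 : s.+2 * r * (r - s.+1) <= s.+1 * (n - s.+1).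
  apply: leq_trans (leq_mul (leqnn _) M1).
  rewrite !mulnA; do 2!apply: leq_mul => //; lia.
have := leq_mul M2 (leqnn C); lia.
Qed.

Lemma many_low_of_bad (B : {set 'I_n}) :
  (forall v, v \notin B -> deg H v <= D) -> #|B| + 2 * r <= n ->
  2 * r <= #|low|.
Proof.
move=> hB h2; have h1 : #|~: low| <= #|B|.
  by apply/subset_leq_card/subsetP=> v; rewrite !inE; apply: contraR => /hB.
have := cardsC low; rewrite card_ord.
by move: h1 h2; move: #|B| #|low| #|~: low| => *; lia.
Qed.

Lemma many_low_no_2cover : H != set0 ->
  (forall T, #|T| < 3 -> exists2 E, E \in H & [disjoint T & E]) ->
  2 * r <= #|low|.
Proof.
move=> /set0Pn[E0 E0H] h3.
pose cover T := [forall E in H, ~~ [disjoint T & E]].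
have covE E : E \in H -> cover E.
  move=> EH; apply/forall_inP => F FH; rewrite -setI_eq0; exact: iH.
case: (arg_minnP (fun T => #|T|) (covE _ E0H)) => T0 cov0 min0.
have hs T : #|T| < #|T0| -> exists2 E, E \in H & [disjoint T & E].
  move=> lt; have : ~~ cover T by apply: contraL lt => /min0; rewrite -leqNgt.
  by rewrite negb_forall_in => /exists_inP[E EH]; rewrite negbK; exists E.
have s3 : 2 < #|T0|.
  rewrite ltnNge; apply/negP=> /h3[E EH dE].
  by move/forall_inP: cov0 => /(_ E EH); rewrite dE.
have sr : #|T0| <= r by rewrite -(uH E0H) min0 ?covE.
have cH : #|H| <= 3 * (r ^ 2 * c).
  apply: leq_trans (branching_bound_mono s3 sr); apply: card_le_through.
    by move=> E EH; rewrite setIC setI_eq0 (forall_inP cov0).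
  move=> u uT; rewrite -subn1 -[in _ - 1](cards1 u).
  apply: leq_trans (@codeg_le _ [set u] hs sr _); last by rewrite cards1; lia.
  by apply/subset_leq_card/subsetP=> E; rewrite !inE sub1set.
apply: (@many_low_of_bad [set v in [set: 'I_n] | D < deg H v]).
  by move=> v; rewrite !inE -leqNgt.
have := @deg_markov _ r H [set: 'I_n] D uH; set b := #|_| => mk.
have Dl := D_lower; have c0 := c_gt0.
rewrite leqNgt; apply/negP=> hb.
(* The strict [hb] provides the successor in [n.+1], which matters here: for [r = 3], [n = 36] the
   chain ends in [217 <= 216], and would end in the true [210 <= 216] without it. *)
have h1 : (n.+1 - 2 * r) * (7 * (r * c)) <= b * (8 * D) by apply: leq_mul => //; lia.
have h2 : b * (8 * D) <= 8 * (r * #|H|) by lia.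
have h3' : 8 * (r * #|H|) <= 8 * (r * (3 * (r ^ 2 * c))) by rewrite !leq_mul.
have : (r * c) * (7 * (n.+1 - 2 * r)) <= (r * c) * (24 * r ^ 2) by lia.
rewrite leq_pmul2l; last by rewrite muln_gt0 c0; lia.
nia.
Qed.

(** * Degrees inside a star *)

Lemma cards3 x y z : x != y -> x != z -> y != z -> #|[set x; y; z]| = 3.
Proof.
move=> xy xz yz; rewrite setUC cardsU1 !inE cards2 xy.
by rewrite eq_sym (negPf xz) eq_sym (negPf yz).
Qed.

Lemma card_three_le K x y z : K \subset H -> x != y -> x != z -> y != z ->
  (forall E, E \in K -> [&& x \in E, y \in E & z \in E]) -> #|K| <= c.
Proof.
move=> sK xy xz yz hK; have c3 := cards3 xy xz yz; rewrite /c -c3.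
apply: card_supersets_le; rewrite ?c3 //; first exact: uniformW.
by move=> E /hK /and3P[xE yE zE]; rewrite !subUset !sub1set xE yE.
Qed.

(** The edges through [x] and [v] and the non-edges in [M] are disjoint families of [r]-sets
    containing both vertices. Exhibiting many such non-edges thus bounds the degree. *)
Lemma deg_star_packing x v (M : {set {set 'I_n}}) : v != x ->
  (forall E, E \in M -> [/\ #|E| = r, x \in E, v \in E & E \notin H]) ->
  deg [set E in H | x \in E] v + #|M| <= 'C(n - 2, r - 2).
Proof.
move=> vx hM; have c2 : #|[set x; v]| = 2 by rewrite cards2 eq_sym vx.
set K := [set E in [set E in H | x \in E] | v \in E].
have hK E : E \in K -> [/\ E \in H, x \in E & v \in E].
  by rewrite !inE => /andP[/andP[]].
have dKM : K :&: M = set0.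
  apply/setP=> E; rewrite inE in_set0; apply/negP=> /andP[/hK[EH _ _] /hM[_ _ _]].
  by rewrite EH.
have -> : deg [set E in H | x \in E] v + #|M| = #|K :|: M|.
  by rewrite cardsU dKM cards0 subn0.
rewrite -c2; apply: card_supersets_le; rewrite ?c2; [|lia|].
  by move=> E; rewrite inE => /orP[/hK[/uH]|/hM[]].
by move=> E; rewrite inE subUset !sub1set => /orP[/hK[_ -> ->]|/hM[_ -> ->]].
Qed.

Lemma deg_star_le x v E1 : E1 \in H -> x \notin E1 -> v \notin E1 -> v != x ->
  deg [set E in H | x \in E] v <= D.
Proof.
move=> E1H xE1 vE1 vx; have c2 : #|[set x; v]| = 2 by rewrite cards2 eq_sym vx.
have := @deg_star_packing x v (draws_between r [set x; v] E1) vx.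
rewrite card_draws_between ?c2 ?(uH E1H) /D; [|
  by rewrite disjoints_subset !subUset !sub1set !inE xE1|lia].
have -> : n - 2 - r = n - r - 2 by lia.
move=> h; rewrite leq_subRL; first rewrite addnC; last by apply: leq_bin2l; lia.
apply: h => E; rewrite inE subUset !sub1set => /and3P[/eqP-> /andP[-> ->] dE].
by split=> //; apply: contraL dE => EH; rewrite -setI_eq0 iH.
Qed.

(** Besides the [r]-sets missing [E1], those through some [a] in [E1] but not in [E2] that miss [E2]
    are non-edges. They contain [a], so they are new, and there are [l] of them. *)
Lemma deg_star_le2 x v E1 E2 : E1 \in H -> E2 \in H -> E1 != E2 ->
  x \notin E1 -> x \notin E2 -> v \notin E1 -> v \notin E2 -> v != x ->
  deg [set E in H | x \in E] v + l <= D.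
Proof.
move=> E1H E2H E12 xE1 xE2 vE1 vE2 vx.
have [a aE1 aE2] : exists2 a, a \in E1 & a \notin E2.
  apply/subsetPn; apply: contra E12 => sE.
  by rewrite eqEcard sE (uH E1H) (uH E2H) leqnn.
have ax : a != x by apply: contraTneq aE1 => ->.
have av : a != v by apply: contraTneq aE1 => ->.
have c2 : #|[set x; v]| = 2 by rewrite cards2 eq_sym vx.
have c3 : #|[set x; v; a]| = 3 by apply: cards3; rewrite eq_sym.
pose M1 := draws_between r [set x; v] E1.
pose M2 := draws_between r [set x; v; a] E2.
have hM1 E : E \in M1 -> [/\ #|E| = r, x \in E, v \in E & [disjoint E & E1]].
  by rewrite inE subUset !sub1set => /and3P[/eqP-> /andP[-> ->]].
have hM2 E : E \in M2 -> [/\ #|E| = r, x \in E, v \in E &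
    a \in E /\ [disjoint E & E2]].
  by rewrite inE !subUset !sub1set => /and3P[/eqP-> /andP[/andP[-> ->] ->]].
have dM : M1 :&: M2 = set0.
  apply/setP=> E; rewrite inE in_set0; apply/negP.
  by case/andP=> /hM1[_ _ _ dE] /hM2[_ _ _ []]; rewrite (disjointFl dE aE1).
have dj1 : [disjoint [set x; v] & E1].
  by rewrite disjoints_subset !subUset !sub1set !inE xE1.
have dj2 : [disjoint [set x; v; a] & E2].
  by rewrite disjoints_subset !subUset !sub1set !inE xE2 vE2.
have cM1 : #|M1| = 'C(n - r - 2, r - 2).
  by rewrite /M1 card_draws_between ?c2 ?(uH E1H) 1?subnAC; [|exact: dj1|exact: ltnW].
have cM2 : #|M2| = l.
  by rewrite /M2 card_draws_between ?c3 ?(uH E2H); [|exact: dj2|].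
have cM : #|M1 :|: M2| = 'C(n - r - 2, r - 2) + l.
  by rewrite cardsU dM cards0 subn0 cM1 cM2.
have := @deg_star_packing x v (M1 :|: M2) vx.
rewrite cM /D => h; rewrite leq_subRL;
  last by rewrite leq_bin2l ?leq_sub2r ?leq_subr.
rewrite addnCA; apply: h => E; rewrite inE.
case/orP=> [/hM1[-> -> -> dE]|/hM2[-> -> -> [_ dE]]].
  by split=> //; apply: contraL dE => EH; rewrite -setI_eq0 iH.
by split=> //; apply: contraL dE => EH; rewrite -setI_eq0 iH.
Qed.

(** * Families covered by two vertices *)

Lemma many_low_triangle x y z : x != y -> x != z -> y != z ->
  (forall E, E \in H ->
     [|| (x \in E) && (y \in E), (x \in E) && (z \in E) | (y \in E) && (z \in E)]) ->
  2 * r <= #|low|.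
Proof.
move=> xy xz yz h2; apply: (@many_low_of_bad [set x; y; z]); last first.
  by rewrite cards3 //; nia.
move=> v; rewrite !inE !negb_or -andbA => /and3P[vx vy vz].
(* For [r >= 4] the bound [7 * r * c <= 8 * D] suffices. For [r = 3] it only gives [D >= 21 / 8], as
   [c = 1], and integrality rounds this up to 3. *)
have D3 : 3 * c <= D.
  have := D_lower; have [r3|r4] := leqP r 3; last first.
    by have : 4 * c <= r * c; [rewrite leq_mul | lia].
  have -> : c = 1 by rewrite /c (_ : r - 3 = 0) ?bin0 //; lia.
  lia.
apply: leq_trans D3; rewrite /deg; set K := [set E in H | v \in E].
pose P u w := [set E in K | (u \in E) && (w \in E)].
have cP u w : u != w -> v != u -> v != w -> #|P u w| <= c.
  move=> uw vu vw; apply: (@card_three_le _ v u w) => //.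
    by apply/subsetP=> E; rewrite !inE => /andP[/andP[]].
  by move=> E; rewrite !inE => /andP[/andP[_ ->]].
have sK : K \subset P x y :|: (P x z :|: P y z).
  by apply/subsetP=> E; rewrite !inE => /andP[EH ->]; rewrite EH /= h2.
apply: leq_trans (subset_leq_card sK) _.
apply: leq_trans (leq_card_setU _ _) _; rewrite mulSn leq_add ?cP //.
by apply: leq_trans (leq_card_setU _ _) _; rewrite mul2n -addnn leq_add ?cP.
Qed.

Lemma many_low_pencil x y z A0 E1 : y != z ->
  (forall E, E \in H -> x \notin E -> (y \in E) && (z \in E)) ->
  A0 \in H -> y \notin A0 -> z \notin A0 -> E1 \in H -> x \notin E1 ->
  2 * r <= #|low|.
Proof.
move=> yz hB A0H yA0 zA0 E1H xE1; set B := [set E in H | x \notin E].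
have sB : B \subset H by apply/subsetP=> E; rewrite inE => /andP[].
have xA0 : x \in A0 by apply: contraR yA0 => /(hB _ A0H) /andP[].
(* An edge of [B] contains [y] and [z] and meets [A0] in one of its [r - 1] vertices other than
   [x]. *)
have cB : #|B| <= (r - 1) * c.
  have -> : r - 1 = #|A0 :\ x| by rewrite -(uH A0H) (cardsD1 x A0) xA0 add1n subn1.
  apply: card_le_through => [E|u].
    rewrite inE => /andP[EH xE]; have /set0Pn[w] := iH EH A0H.
    rewrite inE => /andP[wE wA]; apply/set0Pn; exists w.
    by rewrite !inE wE wA (contraTneq _ wE) // => ->.
  rewrite !inE => /andP[ux uA]; apply: (@card_three_le _ y z u) => //.
  - by apply: subset_trans sB; apply/subsetP=> E; rewrite inE => /andP[].
  - by apply: contraNneq yA0 => ->.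
  - by apply: contraNneq zA0 => ->.
  - by move=> E; rewrite !inE andbA => /andP[/andP[EH xE] ->]; rewrite andbT hB.
(* If [E1] is the only edge of [B], then [B] adds nothing to degrees outside [E1], and [deg_star_le]
   is enough. *)
have [onlyE1|] := boolP [forall E in B, E == E1].
  apply: (@many_low_of_bad (x |: E1)); last first.
    by rewrite cardsU1 xE1 (uH E1H) /=; nia.
  move=> v; rewrite !inE negb_or => /andP[vx vE1].
  rewrite (deg_split H x v) -/B [deg B v](_ : _ = 0) ?addn0.
    exact: deg_star_le E1H _ _ _.
  apply: eq_card0 => E; rewrite inE; apply/negP=> /andP[EB vE].
  have /eqP eE := forall_inP onlyE1 E EB.
  by rewrite -eE vE in vE1.
rewrite negb_forall_in => /exists_inP[E2]; rewrite inE => /andP[E2H xE2] E21.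
(* The threshold is the gain [l] in [deg_star_le2]: outside [V] it pays for the edges of [B] through
   [v]. *)
pose V := [set v in [set: 'I_n] | l < deg B v].
apply: (@many_low_of_bad (x |: (E1 :|: E2) :|: V)).
  move=> v; rewrite !inE !negb_or -!andbA -leqNgt.
  case/and4P=> vx vE1 vE2 vl; rewrite (deg_split H x v) -/B.
  apply: leq_trans (deg_star_le2 E1H E2H _ xE1 xE2 vE1 vE2 vx).
    by rewrite leq_add2l.
  by rewrite eq_sym.
have cV : #|x |: (E1 :|: E2) :|: V| <= 1 + (r + r) + #|V|.
  apply: leq_trans (leq_card_setU _ _) _; rewrite leq_add2r.
  apply: leq_trans (leq_card_setU _ _) _; rewrite cards1 leq_add2l.
  by apply: leq_trans (leq_card_setU _ _) _; rewrite (uH E1H) (uH E2H).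
have := @deg_markov _ r B [set: 'I_n] l (uniformW sB); rewrite -/V => mk.
apply: (leq_trans (leq_add cV (leqnn _))).
exact: pencil_arith hr hn c_gt0 l_lower mk cB.
Qed.

(** An edge avoiding [x] contains [y]. It meets an edge [A1] avoiding [y] in some [u] other than
    [x], then an edge [A2] avoiding [y] and [u] in some [w] other than [x]. Each choice has [r - 1]
    options and leaves at most [c] edges through [y], [u], [w]. *)
Lemma card_avoiding_le x y : x != y ->
  (forall E, E \in H -> (x \in E) || (y \in E)) ->
  (forall u, u != x -> exists2 E, E \in H & (y \notin E) && (u \notin E)) ->
  #|[set E in H | x \notin E]| <= (r - 1) * ((r - 1) * c).
Proof.
move=> xy hxy hA; set B := [set E in H | x \notin E].
have sB : B \subset H by apply/subsetP=> E; rewrite inE => /andP[].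
have hBy E : E \in B -> y \in E.
  by rewrite inE => /andP[EH xE]; move: (hxy _ EH); rewrite (negPf xE).
have cA A : A \in H -> y \notin A -> r - 1 = #|A :\ x|.
  move=> AH yA; have := hxy _ AH; rewrite (negPf yA) orbF => xA.
  by rewrite -(uH AH) (cardsD1 x A) xA add1n subn1.
have meet A E : A \in H -> E \in B -> E :&: (A :\ x) != set0.
  move=> AH; rewrite inE => /andP[EH xE]; have /set0Pn[w] := iH EH AH.
  rewrite inE => /andP[wE wA]; apply/set0Pn; exists w.
  by rewrite !inE wE wA (contraTneq _ wE) // => ->.
have [A1 A1H /andP[yA1 _]] : exists2 E, E \in H & (y \notin E) && (y \notin E).
  by apply: hA; rewrite eq_sym.
rewrite {1}(cA A1) //; apply: card_le_through => [E|u]; first exact: meet.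
rewrite !inE => /andP[ux uA1]; have [A2 A2H /andP[yA2 uA2]] := hA u ux.
rewrite (cA A2) //; apply: card_le_through => [E|w].
  by rewrite inE => /andP[EB _]; exact: meet.
rewrite !inE => /andP[wx wA2]; apply: (@card_three_le _ y u w).
- apply: subset_trans sB; apply/subsetP=> E.
  by rewrite inE => /andP[]; rewrite inE => /andP[].
- by apply: contraNneq yA1 => ->.
- by apply: contraNneq yA2 => ->.
- by apply: contraNneq uA2 => ->.
- move=> E; rewrite inE => /andP[]; rewrite inE => /andP[EB -> ->].
  by rewrite hBy.
Qed.

Lemma many_low_two_cover_generic x y : x != y ->
  (forall E, E \in H -> (x \in E) || (y \in E)) ->
  (forall u, u != x -> exists2 E, E \in H & (y \notin E) && (u \notin E)) ->
  (forall u, u != y -> exists2 E, E \in H & (x \notin E) && (u \notin E)) ->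
  2 * r <= #|low|.
Proof.
move=> xy hxy hA hB; have yx : y != x by rewrite eq_sym.
have cB := card_avoiding_le xy hxy hA.
have cA := @card_avoiding_le y x yx (fun E EH => etrans (orbC _ _) (hxy E EH)) hB.
pose K := [set E in H | ~~ ((x \in E) && (y \in E))].
have sK : K \subset H by apply/subsetP=> E; rewrite inE => /andP[].
have cK : #|K| <= (r - 1) * ((r - 1) * c) + (r - 1) * ((r - 1) * c).
  apply: leq_trans (leq_add cB cA); apply: leq_trans (leq_card_setU _ _).
  apply/subset_leq_card/subsetP=> E; rewrite !inE negb_and.
  by case/andP=> -> /=.
(* The reserve [c] is for the edges containing [v], [x] and [y], which [K] omits. *)
pose V := [set v in [set: 'I_n] | D - c < deg K v].
have Dl := D_lower; have c0 := c_gt0.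
have cD : c <= D by have : 3 * c <= r * c; [rewrite leq_mul | lia].
apply: (@many_low_of_bad ([set x; y] :|: V)).
  move=> v; rewrite !inE !negb_or -!andbA -leqNgt.
  case/and3P=> vx vy vK; rewrite -(subnKC cD).
  apply: leq_trans (leq_add (leqnn c) vK).
  have cC : #|[set E in H | [&& v \in E, x \in E & y \in E]]| <= c.
    apply: (@card_three_le _ v x y) => //.
      by apply/subsetP=> E; rewrite inE => /andP[].
    by move=> E; rewrite inE => /andP[].
  apply: leq_trans (leq_add cC (leqnn _)); apply: leq_trans (leq_card_setU _ _).
  apply/subset_leq_card/subsetP=> E; rewrite !inE => /andP[-> ->] /=.
  by rewrite andbT orbN.
have cV : #|[set x; y] :|: V| <= 2 + #|V|.
  by apply: leq_trans (leq_card_setU _ _) _; rewrite cards2 xy.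
have := @deg_markov _ r K [set: 'I_n] (D - c) (uniformW sK); rewrite -/V => mk.
apply: (leq_trans (leq_add cV (leqnn _))).
exact: two_cover_arith hr hn c0 Dl mk cK.
Qed.

Lemma many_low_two_cover_side x y z E1 : x != y -> z != y ->
  (forall E, E \in H -> (x \in E) || (y \in E)) ->
  (forall E, E \in H -> x \notin E -> z \in E) ->
  E1 \in H -> x \notin E1 -> 2 * r <= #|low|.
Proof.
move=> xy zy hxy hz E1H xE1.
have zx : z != x by apply: (contraNneq _ xE1) => <-; apply: hz.
have [hA|] := boolP [forall E in H, (y \notin E) ==> (z \in E)].
  apply: (@many_low_triangle x y z) => //; try by rewrite eq_sym.
  move=> E EH; have /implyP := forall_inP hA E EH; have := hxy E EH.
  have := hz E EH; case: (x \in E); case: (y \in E) => //=.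
  - by move=> _ _ ->.
  - by move=> ->.
rewrite negb_forall_in => /exists_inP[A0 A0H]; rewrite negb_imply => /andP[yA0 zA0].
apply: (@many_low_pencil x y z A0 E1) => //; first by rewrite eq_sym.
move=> E EH xE; rewrite hz // andbT; have := hxy E EH; by rewrite (negPf xE).
Qed.

Lemma many_low : (forall v, exists2 E, E \in H & v \notin E) -> H != set0 ->
  2 * r <= #|low|.
Proof.
move=> nt H0; have /set0Pn[E0 E0H] := H0.
have [|no2] := boolP [exists T : {set 'I_n},
    (#|T| < 3) && [forall E in H, ~~ [disjoint T & E]]]; last first.
  apply: many_low_no_2cover => // T cT; move: no2.
  rewrite negb_exists => /forallP/(_ T); rewrite cT negb_forall_in.
  by case/exists_inP=> E EH; rewrite negbK; exists E.
case/existsP=> T /andP[cT /forall_inP covT].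
have : ~~ [disjoint T & E0] := covT _ E0H.
(* By non-triviality some edge avoids [x]; [T] meets it in a second vertex [y], so [T] is exactly
   the pair [x], [y]. *)
rewrite -setI_eq0 => /set0Pn[x]; rewrite inE => /andP[xT _].
have [Ex ExH xEx] := nt x.
have := covT _ ExH; rewrite -setI_eq0 => /set0Pn[y]; rewrite inE => /andP[yT yEx].
have xy : x != y by apply: contraNneq xEx => ->.
have eT : [set x; y] = T.
  by apply/eqP; rewrite eqEcard subUset !sub1set xT yT cards2 xy.
have hxy E : E \in H -> (x \in E) || (y \in E).
  by move/covT; rewrite -eT disjoints_subset !subUset !sub1set !inE negb_and !negbK.
have [Ey EyH yEy] := nt y.
have side u w :
   ~~ [exists z, (z != w) && [forall E in H, (u \notin E) ==> (z \in E)]] ->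
   forall z, z != w -> exists2 E, E \in H & (u \notin E) && (z \notin E).
  rewrite negb_exists => /forallP h z zw.
  move: (h z); rewrite zw negb_forall_in => /exists_inP[F FH].
  by rewrite negb_imply; exists F.
have [/existsP[z /andP[zy /forall_inP hz]]|nB] :=
  boolP [exists z, (z != y) && [forall E in H, (x \notin E) ==> (z \in E)]].
  apply: (@many_low_two_cover_side x y z Ex) => // E EH; exact/implyP/hz.
have [/existsP[z /andP[zx /forall_inP hz]]|nA] :=
  boolP [exists z, (z != x) && [forall E in H, (y \notin E) ==> (z \in E)]].
  apply: (@many_low_two_cover_side y x z Ey) => //.
  - by rewrite eq_sym.
  - by move=> E EH; rewrite orbC hxy.
  - by move=> E EH; exact/implyP/hz.
exact: many_low_two_cover_generic xy hxy (side _ _ nA) (side _ _ nB).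
Qed.

End Extremal.

Theorem theorem1p5 (r n : nat) (H : {set {set 'I_n}})
  (hr : 3 <= r) (hn : 4 * r ^ 2 <= n)
  (hunif : uniform r H) (hint : intersecting H)
  (hnontriv : ~ trivial_family r H) :
  ore_degree r H <= r * ('C(n - 2, r - 2) - 'C(n - r - 2, r - 2)).
Proof.
have nt v : exists2 E, E \in H & v \notin E.
  have : ~~ (H \subset star r v) by apply/negP=> sH; apply: hnontriv; exists v.
  case/subsetPn=> E EH; rewrite inE (hunif _ EH) eqxx /=; by exists E.
have n0 : 0 < n by nia.
apply: ore_degree_le_of_low_degrees => //; first by lia.
apply: many_low => //.
by have [E EH _] := nt (Ordinal n0); apply/set0Pn; exists E.
Qed.
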